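(* Let $m$ be a positive integer, $p$ an odd prime, and $a\in\mathbb{Z}_p$ with $a\not\equiv0\pmod p$. Then $$\sum_{k=0}^{p-1}\binom ak^m\sum_{r=0}^{[\frac{m-1}2]}\binom m{2r+1}\Big(1-\frac 2ak\Big)^{2r+1}\equiv\sum_{k=0}^{p-1}(-1)^k\binom ak^m\sum_{r=0}^{[m/2]}\binom m{2r}\Big(1-\frac2ak\Big)^{2r}\equiv2^{m-1}\frac{(a-\langle a\rangle_p)^m}{a^m}\big(1+mpH_{\langle a\rangle_p}\big)\pmod{p^{m+2}}.$$
   Context: $\mathbb{Z}_p$ denotes the set of rational numbers whose denominator is not divisible by $p$; congruences are taken in $\mathbb{Z}_p$. For $a\in\mathbb{Z}_p$, $\langle a\rangle_p$ is the unique integer in $\{0,1,\dots,p-1\}$ with $a\equiv\langle a\rangle_p\pmod p$. The general binomial coefficient is $\binom a0=1$, $\binom ak=a(a-1)\cdots(a-k+1)/k!$ for $k\ge1$. $[x]$ is the greatest integer not exceeding $x$. $H_0=0$, $H_n=1+\frac12+\cdots+\frac1n$. *)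

(* Defs.v *)
From mathcomp Require Import all_boot all_order all_algebra.
From mathcomp Require Import ring lra.

Set Implicit Arguments.
Unset Strict Implicit.
Unset Printing Implicit Defensive.

Import Order.TTheory GRing.Theory Num.Theory.
Local Open Scope ring_scope.

(* The ring Z_p of rationals with denominator prime to p (not the p-adic
   completion); denq is the denominator in lowest terms. *)
Definition Zloc (p : nat) : {pred rat} :=
  [pred x : rat | ~~ (p %| `|denq x|)%N].

(* x = y (mod p^n) in Z_p, i.e. x - y \in p^n Z_p. *)
Definition eqmodZloc (p n : nat) (x y : rat) : bool :=
  (x - y) / p%:R ^+ n \in Zloc p.

(* <a>_p, as the least t in {0, ..., p-1} with a = t (mod p); for p prime and
   a in Z_p there is exactly one such t, by residue_spec and residue_uniq.
   (If there is none, find returns p.) *)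
Definition residue (p : nat) (a : rat) : nat :=
  find (fun t : nat => eqmodZloc p 1 a t%:R) (iota 0 p).

Definition gbinom (a : rat) (k : nat) : rat :=
  (\prod_(i < k) (a - i%:R)) / (k`!)%:R.

Definition harmonic (n : nat) : rat := \sum_(1 <= i < n.+1) (i%:R)^-1.

Lemma ZlocP (p : nat) (x : rat) (n d : int) :
  prime p -> ~~ (p %| `|d|)%N -> x * d%:~R = n%:~R -> x \in Zloc p.
Proof.
move=> pp pd e; rewrite inE; apply: contra pd => pdx.
have dx0 : (denq x)%:~R != 0 :> rat by rewrite intr_eq0 denq_neq0.
have E : numq x * d = n * denq x.
  apply/eqP; rewrite -(eqr_int rat) !rmorphM /= -e; apply/eqP.
  by rewrite -[X in _ = X * _ * _]divq_num_den; field.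
have : (p %| `|(numq x * d)%R|)%N by rewrite E abszM dvdn_mull.
rewrite abszM Euclid_dvdM // => /orP[pn|//].
have := coprime_num_den x; rewrite /coprime => /eqP g1.
have : (p %| gcdn `|numq x| `|denq x|)%N by rewrite dvdn_gcd pn pdx.
by rewrite g1 dvdn1 => /eqP p1; rewrite p1 in pp.
Qed.

Lemma Zloc_subr (p : nat) (x y : rat) :
  prime p -> x \in Zloc p -> y \in Zloc p -> x - y \in Zloc p.
Proof.
move=> pp; rewrite !inE => hx hy.
apply: (@ZlocP p _ (numq x * denq y - numq y * denq x) (denq x * denq y)) => //.
  by rewrite abszM Euclid_dvdM // negb_or hx.
have dx0 : (denq x)%:~R != 0 :> rat by rewrite intr_eq0 denq_neq0.
have dy0 : (denq y)%:~R != 0 :> rat by rewrite intr_eq0 denq_neq0.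
rewrite rmorphB !rmorphM /= -[X in (X - _) * _]divq_num_den.
by rewrite -[X in (_ - X) * _]divq_num_den; field; rewrite dx0 dy0.
Qed.

Lemma residue_ex (p : nat) (a : rat) : prime p -> a \in Zloc p ->
  exists2 t : nat, (t < p)%N & eqmodZloc p 1 a t%:R.
Proof.
move=> pp; rewrite inE => ha.
have p0 : (p%:Z) != 0 by rewrite eqz_nat -lt0n prime_gt0.
have cop : coprimez (denq a) p%:Z by rewrite coprimezE coprime_sym prime_coprime.
have [u [v]] := Bezoutz (denq a) p%:Z; rewrite (eqP cop) => uv.
set z := numq a * u; exists `|(z %% p%:Z)%Z|%N.
  rewrite -ltz_nat gez0_abs ?modz_ge0 //.
  by rewrite ltz_pmod // ltz_nat prime_gt0.
rewrite /eqmodZloc expr1.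
apply: (@ZlocP p _ (numq a * v + (z %/ p%:Z)%Z * denq a) (denq a)) => //.
have -> : `|(z %% p%:Z)%Z|%N%:R = ((z %% p%:Z)%Z)%:~R :> rat.
  by rewrite [LHS]pmulrn gez0_abs ?modz_ge0.
have da : (denq a)%:~R != 0 :> rat by rewrite intr_eq0 denq_neq0.
have pr : p%:R != 0 :> rat by rewrite pnatr_eq0 -lt0n prime_gt0.
have E1 : a * (denq a)%:~R = (numq a)%:~R by rewrite -[X in X * _]divq_num_den divfK.
have E2 : (z %% p%:Z)%Z%:~R = (numq a)%:~R * u%:~R - ((z %/ p%:Z)%Z)%:~R * p%:R :> rat.
  rewrite {1}/modz rmorphB /= !rmorphM /=; congr (_ - _).
have E3 : u%:~R * (denq a)%:~R + v%:~R * p%:R = 1 :> rat.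
  by have /(congr1 (fun i : int => i%:~R : rat)) := uv; rewrite rmorphD !rmorphM.
rewrite mulrAC mulrBl E1 E2 rmorphD !rmorphM /=.
apply: (mulIf pr); rewrite divfK //.
have E4 : v%:~R * p%:R = 1 - u%:~R * (denq a)%:~R :> rat.
  by apply/esym/eqP; rewrite subr_eq addrC E3.
rewrite [RHS]mulrDl -[X in _ = X + _]mulrA E4; ring.
Qed.

Lemma residue_spec (p : nat) (a : rat) : prime p -> a \in Zloc p ->
  (residue p a < p)%N /\ eqmodZloc p 1 a (residue p a)%:R.
Proof.
move=> pp ha; have [t tp ht] := residue_ex pp ha.
have H : has (fun t : nat => eqmodZloc p 1 a t%:R) (iota 0 p).
  by apply/hasP; exists t; rewrite ?mem_iota.
have lt : (residue p a < p)%N by move: H; rewrite has_find size_iota.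
by split=> //; have := nth_find 0%N H; rewrite nth_iota.
Qed.

Lemma residue_uniq (p : nat) (a : rat) (t : nat) : prime p -> a \in Zloc p ->
  (t < p)%N -> eqmodZloc p 1 a t%:R -> t = residue p a.
Proof.
move=> pp ha tp ht; have [sp hs] := residue_spec pp ha.
move: (residue p a) sp hs => s sp hs.
have := Zloc_subr pp hs ht; rewrite expr1.
have pr : p%:R != 0 :> rat by rewrite pnatr_eq0 -lt0n prime_gt0.
set x := _ - _ => hx.
have xp : x * p%:R = t%:R - s%:R by rewrite /x; field.
have dx0 : (denq x)%:~R != 0 :> rat by rewrite intr_eq0 denq_neq0.
have E : numq x * p%:Z = (t%:Z - s%:Z) * denq x.
  apply/eqP; rewrite -(eqr_int rat) !rmorphM rmorphB /=; apply/eqP.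
  rewrite -[(Posz p)%:~R]/(p%:R : rat) -[(Posz t)%:~R]/(t%:R : rat).
  rewrite -[(Posz s)%:~R]/(s%:R : rat) -xp.
  by rewrite -[X in _ = X * _ * _]divq_num_den; field.
have : (p %| `|((t%:Z - s%:Z) * denq x)%R|)%N by rewrite -E abszM dvdn_mull.
rewrite abszM Euclid_dvdM //; move: hx; rewrite inE => /negbTE ->; rewrite orbF.
move=> hd; have : (t%:Z == s%:Z %[mod p])%Z by rewrite eqz_mod_dvd dvdzE.
by rewrite !modz_nat eqz_nat !modn_small // => /eqP.
Qed.

(* Main.v *)
Require Import Defs.
From mathcomp Require Import all_boot all_order all_algebra.
From mathcomp Require Import ring zify.

Set Implicit Arguments.
Unset Strict Implicit.
Unset Printing Implicit Defensive.

Import Order.TTheory GRing.Theory Num.Theory.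
Local Open Scope ring_scope.

(** With x = 1 - 2k/a, the odd and even parts of (1 + x)^m are
    2^(m-1) ((1 - k/a)^m -+ (k/a)^m), and multiplying by binom(a,k)^m gives
    2^(m-1) (binom(a-1,k)^m -+ binom(a-1,k-1)^m).  Both sums therefore telescope
    to exactly 2^(m-1) binom(a-1,p-1)^m.  Writing a = t + p s with t = <a>_p,
    binom(a-1,p-1) = (a-t)/a * prod_(0<j<p) (1 + p (s - [t < j]) / j), and the
    product is 1 + p (H_t + (s-1) H_(p-1)) = 1 + p H_t mod p^2, since p divides
    H_(p-1).  The factor (a-t)^m supplies the remaining p^m. *)

(** * Even and odd parts of the binomial expansion *)

Section BinomialSums.

Variables (F : numFieldType) (x : F).

Lemma sum_nat_even_odd (f : nat -> F) n :
  \sum_(0 <= i < 2 * n) f i =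
  \sum_(0 <= r < n) f (2 * r)%N + \sum_(0 <= r < n) f (2 * r + 1)%N.
Proof.
elim: n => [|n IH]; first by rewrite muln0 !big_geq // addr0.
have -> : (2 * n.+1 = (2 * n).+2)%N by lia.
by rewrite !big_nat_recr //= IH addn1; ring.
Qed.

(** The coefficients past [m] vanish, so the range may be lengthened to an even number of indices
    and then split by parity. *)
Lemma sum_bin_wide (y : F) m n : (m < n)%N ->
  \sum_(0 <= i < n) 'C(m, i)%:R * y ^+ i = (1 + y) ^+ m.
Proof.
move=> mn; rewrite (@big_cat_nat _ _ _ m.+1) //= [X in _ + X]big_nat [X in _ + X]big1 ?addr0.
  rewrite exprDn big_mkord; apply: eq_bigr => i _.
  by rewrite expr1n mul1r mulr_natl.
by move=> i /andP[mi _]; rewrite bin_small // mul0r.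
Qed.

Lemma expr_opp_even r : (- x) ^+ (2 * r) = x ^+ (2 * r).
Proof. by rewrite !exprM sqrrN. Qed.

Lemma expr_opp_odd r : (- x) ^+ (2 * r + 1) = - x ^+ (2 * r + 1).
Proof. by rewrite addn1 !exprS expr_opp_even mulNr. Qed.

Lemma sum_bin_even m :
  \sum_(0 <= r < (m %/ 2).+1) 'C(m, 2 * r)%:R * x ^+ (2 * r) =
  ((1 + x) ^+ m + (1 - x) ^+ m) / 2%:R.
Proof.
have mn : (m < 2 * (m %/ 2).+1)%N by lia.
rewrite -(sum_bin_wide x mn) -(sum_bin_wide (- x) mn) !sum_nat_even_odd.
under [X in _ + (X + _)]eq_bigr => i _ do rewrite expr_opp_even.
under [X in _ + (_ + X)]eq_bigr => i _ do rewrite expr_opp_odd mulrN.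
by rewrite sumrN; field.
Qed.

Lemma sum_bin_odd m : (0 < m)%N ->
  \sum_(0 <= r < ((m - 1) %/ 2).+1) 'C(m, 2 * r + 1)%:R * x ^+ (2 * r + 1) =
  ((1 + x) ^+ m - (1 - x) ^+ m) / 2%:R.
Proof.
move=> m0; set n := ((m - 1) %/ 2).+1.
have mn : (m < 2 * n.+1)%N by rewrite /n; lia.
(* For even [m] the indices below [2 * n] miss [m] itself; the range is extended by [r = n], whose
   odd coefficient is zero. *)
have -> : \sum_(0 <= r < n) 'C(m, 2 * r + 1)%:R * x ^+ (2 * r + 1) =
          \sum_(0 <= r < n.+1) 'C(m, 2 * r + 1)%:R * x ^+ (2 * r + 1).
  by rewrite [RHS]big_nat_recr //= bin_small ?mul0r ?addr0 // /n; lia.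
rewrite -(sum_bin_wide x mn) -(sum_bin_wide (- x) mn) !sum_nat_even_odd.
under [X in _ - (X + _)]eq_bigr => i _ do rewrite expr_opp_even.
under [X in _ - (_ + X)]eq_bigr => i _ do rewrite expr_opp_odd mulrN.
by rewrite sumrN; field.
Qed.

End BinomialSums.

(** * Absorption identities for generalized binomial coefficients *)

Lemma natr_fact_neq0 k : k`!%:R != 0 :> rat.
Proof. by rewrite pnatr_eq0 -lt0n fact_gt0. Qed.

Lemma gbinom0 a : gbinom a 0 = 1.
Proof. by rewrite /gbinom big_ord0 divr1. Qed.

Lemma prod_gbinom a k : \prod_(i < k) (a - i%:R) = gbinom a k * k`!%:R.
Proof. by rewrite /gbinom divfK ?natr_fact_neq0. Qed.

(** Taking out the factor [i = 0] shifts [a] to [a - 1]. Taking out the last factor instead yields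
    [gbinom_mul_sub]; reading the whole product as [gbinom a k.+1] yields [gbinomS_mul]. *)
Lemma prod_gbinom_pred a k :
  \prod_(i < k.+1) (a - i%:R) = a * (gbinom (a - 1) k * k`!%:R).
Proof.
rewrite big_ord_recl subr0 -prod_gbinom; congr (_ * _).
by apply: eq_bigr => i _; rewrite /= -natr1; ring.
Qed.

Lemma gbinom_mul_sub a k : a != 0 ->
  gbinom a k * (1 - k%:R / a) = gbinom (a - 1) k.
Proof.
move=> a0; have k0 := natr_fact_neq0 k.
have := prod_gbinom_pred a k; rewrite big_ord_recr /= prod_gbinom => E.
apply: (mulfI a0); apply: (mulIf k0); rewrite -[RHS]mulrA -E.
by field.
Qed.

Lemma gbinomS_mul a k : a != 0 ->
  gbinom a k.+1 * (k.+1%:R / a) = gbinom (a - 1) k.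
Proof.
move=> a0; have k0 := natr_fact_neq0 k.
have := prod_gbinom_pred a k; rewrite prod_gbinom factS natrM => E.
apply: (mulfI a0); apply: (mulIf k0); rewrite -[RHS]mulrA -E.
by field.
Qed.

(** * Exact evaluation of both sums by telescoping *)

Section Telescoping.

Variables (a : rat) (m : nat).
Hypotheses (a0 : a != 0) (m0 : (0 < m)%N).

Lemma half_expr2 : 2%:R ^+ m / 2%:R = 2%:R ^+ (m - 1) :> rat.
Proof. by case: m m0 => // k _; rewrite subn1 exprS mulrAC divff // mul1r. Qed.

Lemma gbinom_expr_plus k :
  gbinom a k ^+ m * (1 + (1 - 2%:R / a * k%:R)) ^+ m =
  2%:R ^+ m * gbinom (a - 1) k ^+ m.
Proof.
rewrite -!exprMn -(gbinom_mul_sub k a0); congr (_ ^+ _); by field.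
Qed.

(** Here [1 - x = 2 k / a], which lowers the index by one; hence the form with [k.+1]. *)
Lemma gbinom_expr_minus k :
  gbinom a k.+1 ^+ m * (1 - (1 - 2%:R / a * k.+1%:R)) ^+ m =
  2%:R ^+ m * gbinom (a - 1) k ^+ m.
Proof.
rewrite -!exprMn -(gbinomS_mul k a0); congr (_ ^+ _); by field.
Qed.

Lemma gbinom_sum_odd n :
  \sum_(0 <= k < n.+1) gbinom a k ^+ m *
    \sum_(0 <= r < ((m - 1) %/ 2).+1)
      'C(m, 2 * r + 1)%:R * (1 - 2%:R / a * k%:R) ^+ (2 * r + 1) =
  2%:R ^+ (m - 1) * gbinom (a - 1) n ^+ m.
Proof.
rewrite -half_expr2; elim: n => [|n IH].
  rewrite big_nat1 sum_bin_odd // mulrA mulrBr gbinom_expr_plus.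
  (* At [k = 0] one has [x = 1], and [(1 - x) ^+ m = 0] since [m] is positive: no lower boundary
     term appears. *)
  by rewrite mulr0 subr0 subrr expr0n (gtn_eqF m0) mulr0 subr0 mulrAC.
rewrite big_nat_recr //= IH sum_bin_odd // mulrA mulrBr gbinom_expr_plus.
by rewrite gbinom_expr_minus; ring.
Qed.

(** With [B k = gbinom (a - 1) k ^+ m], the sign makes the sum [B k + B (k - 1)] a difference of
    consecutive values of [(-1) ^+ k * B k]. *)
Lemma gbinom_sum_even n :
  \sum_(0 <= k < n.+1) (-1) ^+ k * gbinom a k ^+ m *
    \sum_(0 <= r < (m %/ 2).+1)
      'C(m, 2 * r)%:R * (1 - 2%:R / a * k%:R) ^+ (2 * r) =
  (-1) ^+ n * (2%:R ^+ (m - 1) * gbinom (a - 1) n ^+ m).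
Proof.
rewrite -half_expr2; elim: n => [|n IH].
  rewrite big_nat1 sum_bin_even expr0 !mul1r mulrA mulrDr gbinom_expr_plus.
  by rewrite mulr0 subr0 subrr expr0n (gtn_eqF m0) mulr0 addr0 mulrAC.
rewrite big_nat_recr //= IH sum_bin_even -(mulrA (_ ^+ n.+1)).
rewrite [gbinom _ _ ^+ _ * (_ / _)]mulrA mulrDr gbinom_expr_plus.
by rewrite gbinom_expr_minus exprS; ring.
Qed.

End Telescoping.

(** * Ring structure of Z_p and congruences modulo powers of [p] *)

Section Localization.

Variable p : nat.
Hypothesis p_prime : prime p.

Lemma natr_prime_neq0 : p%:R != 0 :> rat.
Proof. by rewrite pnatr_eq0 -lt0n prime_gt0. Qed.

Lemma Zloc1 : 1 \in Zloc p.
Proof. by rewrite inE dvdn1; case: eqP p_prime => // ->. Qed.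

Lemma Zloc0 : 0 \in Zloc p.
Proof. by rewrite -(subrr 1) Zloc_subr ?Zloc1. Qed.

Lemma ZlocN x : x \in Zloc p -> - x \in Zloc p.
Proof. by move=> hx; rewrite -sub0r Zloc_subr ?Zloc0. Qed.

Lemma ZlocD x y : x \in Zloc p -> y \in Zloc p -> x + y \in Zloc p.
Proof. by move=> hx hy; rewrite -(opprK y) Zloc_subr ?ZlocN. Qed.

Lemma ZlocM x y : x \in Zloc p -> y \in Zloc p -> x * y \in Zloc p.
Proof.
rewrite !inE => hx hy.
apply: (@ZlocP p _ (numq x * numq y) (denq x * denq y)) => //.
  by rewrite abszM Euclid_dvdM // negb_or hx.
have dx0 : (denq x)%:~R != 0 :> rat by rewrite intr_eq0 denq_neq0.
have dy0 : (denq y)%:~R != 0 :> rat by rewrite intr_eq0 denq_neq0.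
rewrite !rmorphM /= -[X in X * _ * _]divq_num_den.
by rewrite -[X in _ * X * _]divq_num_den; field; rewrite dx0 dy0.
Qed.

Lemma ZlocX x n : x \in Zloc p -> x ^+ n \in Zloc p.
Proof.
by move=> hx; elim: n => [|n IH]; rewrite ?expr0 ?Zloc1 // exprS ZlocM.
Qed.

Lemma Zloc_nat n : n%:R \in Zloc p.
Proof. by elim: n => [|n IH]; rewrite ?Zloc0 // -natr1 ZlocD ?Zloc1. Qed.

Lemma Zloc_sum (f : nat -> rat) i j :
  (forall k, (i <= k < j)%N -> f k \in Zloc p) ->
  \sum_(i <= k < j) f k \in Zloc p.
Proof.
move=> hf; rewrite big_nat_cond.
apply: (@big_rec _ (fun x => x \in Zloc p)); first exact: Zloc0.
by move=> k x /andP[/hf hk _] hx; rewrite ZlocD.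
Qed.

Lemma Zloc_natV n : (0 < n < p)%N -> n%:R^-1 \in Zloc p.
Proof.
move=> /andP[n0 np]; apply: (@ZlocP p _ 1 n) => //.
  by rewrite absz_nat gtnNdvd.
by rewrite pmulrn mulVf // intr_eq0 eqz_nat -lt0n.
Qed.

Lemma ZlocV x : x \in Zloc p -> ~~ eqmodZloc p 1 x 0 -> x^-1 \in Zloc p.
Proof.
move=> hx hx0; have d0 : (denq x)%:~R != 0 :> rat by rewrite intr_eq0 denq_neq0.
have x0 : x != 0.
  by apply: contraNneq hx0 => ->; rewrite /eqmodZloc subrr mul0r Zloc0.
apply: (@ZlocP p _ (denq x) (numq x)) => //; last first.
  by rewrite -[X in X^-1]divq_num_den; field; rewrite d0 intr_eq0 numq_eq0.
(* If [p] divided the numerator, [x / p] would lie in Z_p, so [x] would be 0 modulo [p]. *)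
apply: contra hx0 => /dvdnP[q qE].
have /dvdzP[z zE] : (p%:Z %| numq x)%Z by rewrite dvdzE /= qE dvdn_mull.
rewrite /eqmodZloc subr0 expr1; apply: (@ZlocP p _ z (denq x)) => //.
have p0 := natr_prime_neq0.
by rewrite -[X in X / _]divq_num_den zE rmorphM /= -pmulrn; field; rewrite p0.
Qed.

Lemma eqmodZloc_intro n x y z : z \in Zloc p -> x = y + p%:R ^+ n * z ->
  eqmodZloc p n x y.
Proof.
move=> hz ->; rewrite /eqmodZloc addrAC subrr add0r mulrAC divff ?mul1r //.
by rewrite expf_neq0 ?natr_prime_neq0.
Qed.

Lemma eqmodZloc_elim n x y : eqmodZloc p n x y ->
  exists2 z, z \in Zloc p & x = y + p%:R ^+ n * z.
Proof.
move=> h; exists ((x - y) / p%:R ^+ n) => //.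
by rewrite mulrC divfK ?expf_neq0 ?natr_prime_neq0 // addrC subrK.
Qed.

Lemma prod_1Dp_mod_p2 (x : nat -> rat) i j :
  (forall k, (i <= k < j)%N -> x k \in Zloc p) ->
  eqmodZloc p 2 (\prod_(i <= k < j) (1 + p%:R * x k))
                (1 + p%:R * \sum_(i <= k < j) x k).
Proof.
elim: j => [|j IH] hx.
  by rewrite !big_geq // mulr0 addr0; apply: (eqmodZloc_intro (z := 0));
    [exact: Zloc0 | rewrite mulr0 addr0].
have [ij|ji] := leqP i j; last first.
  rewrite !big_geq // mulr0 addr0; apply: (eqmodZloc_intro (z := 0)).
    exact: Zloc0.
  by rewrite mulr0 addr0.
have hx' k : (i <= k < j)%N -> x k \in Zloc p.
  by move=> /andP[ik kj]; apply: hx; rewrite ik ltnW.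
have hj : x j \in Zloc p by apply: hx; rewrite ij ltnSn.
have [z hz zE] := eqmodZloc_elim (IH hx').
rewrite !big_nat_recr //= zE; set S := \sum_(i <= k < j) x k.
(* [S * x j] is the cross term of [(1 + p S) (1 + p x_j)]; the rest is the old error times the new
   factor. *)
apply: (eqmodZloc_intro (z := S * x j + z * (1 + p%:R * x j))); last by ring.
have hS : S \in Zloc p by exact: Zloc_sum.
by rewrite ZlocD // ZlocM // ?ZlocD ?ZlocM ?Zloc1 ?Zloc_nat.
Qed.

Lemma expr_1Dp_mod_p2 x b m : x \in Zloc p ->
  eqmodZloc p 2 b (1 + p%:R * x) ->
  eqmodZloc p 2 (b ^+ m) (1 + m%:R * p%:R * x).
Proof.
move=> hx /eqmodZloc_elim[z hz bE]; elim: m => [|m IH].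
  apply: (eqmodZloc_intro (z := 0)); first exact: Zloc0.
  by rewrite expr0; ring.
have [w hw wE] := eqmodZloc_elim IH.
(* The coefficient of [p ^ 2] in [(1 + m p x + p^2 w) b], where [b = 1 + p x + p^2 z]. *)
pose y := (1 + m%:R * p%:R * x) * z + w * b + m%:R * x ^+ 2.
apply: (eqmodZloc_intro (z := y)).
  have hp := Zloc_nat p; have hm := Zloc_nat m; have h1 := Zloc1.
  by rewrite /y bE; do ?[apply: ZlocX | apply: ZlocM | apply: ZlocD].
by rewrite exprSr wE /y bE -natr1; ring.
Qed.

(** * The binomial coefficient of [a - 1] over [p - 1] *)

Hypothesis p_odd : odd p.

(* Pairing j with p - j: 2 H_(p-1) = p sum_(0<j<p) 1 / (j (p - j)). *)
Lemma harmonic_pred_prime : eqmodZloc p 1 (harmonic p.-1) 0.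
Proof.
have p0 := prime_gt0 p_prime.
rewrite /harmonic prednK //.
pose S : rat := \sum_(1 <= j < p) j%:R^-1 * (p - j)%:R^-1.
apply: (eqmodZloc_intro (z := 2%:R^-1 * S)).
  have p2 : (2 < p)%N by case: p p_prime p_odd => [|[|[|]]].
  rewrite ZlocM ?Zloc_natV //; apply: Zloc_sum => j /andP[j0 jp].
  by rewrite ZlocM ?Zloc_natV //; lia.
rewrite add0r expr1; apply: (@mulfI _ 2%:R) => //.
rewrite mulrCA mulVKf // mulrC mulr_natr mulr2n {1}big_nat_rev /=.
rewrite -big_split /S /= mulr_sumr; apply: eq_big_nat => j /andP[j0 jp].
rewrite add1n subSS natrB 1?ltnW //.
have j0' : j%:R != 0 :> rat by rewrite pnatr_eq0 -lt0n.
have pj0 : p%:R - j%:R != 0 :> rat.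
  by rewrite -natrB 1?ltnW // pnatr_eq0 -lt0n subn_gt0.
by field; rewrite j0' pj0.
Qed.

(* The factors a - i with i < t are j + p s (j = t - i), those with i > t are
   j + p (s - 1) (j = p + t - i); dividing by (p-1)! normalizes both. *)
Lemma gbinom_pred_prime (s : rat) t : (t < p)%N ->
  let a := t%:R + p%:R * s in
  a * gbinom (a - 1) p.-1 =
  (a - t%:R) * \prod_(1 <= j < p) (1 + p%:R * ((s - (t < j)%N%:R) / j%:R)).
Proof.
move=> tp a; have p0 := prime_gt0 p_prime.
have F0 := natr_fact_neq0 p.-1.
apply: (mulIf F0); rewrite -mulrA -prod_gbinom_pred prednK //.
rewrite -(big_mkord xpredT (fun i => a - i%:R)).
rewrite (@big_cat_nat _ _ _ t) //=; last exact: ltnW.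
rewrite (@big_ltn _ _ _ t) //=.
rewrite fact_prod prednK // natr_prod -mulrA -big_split /=.
rewrite (@big_cat_nat _ _ _ t.+1 1 p) //= mulrCA; congr (_ * (_ * _)).
  rewrite big_nat_rev big_add1 /=; apply: eq_big_nat => j /andP[_ jt].
  have j0 : j.+1%:R != 0 :> rat by rewrite pnatr_eq0.
  by rewrite add0n ltnNge jt natrB // subr0 /a; field; rewrite nat1r j0.
rewrite big_nat_rev; apply: eq_big_nat => j /andP[tj jp].
have j0 : j%:R != 0 :> rat by rewrite pnatr_eq0 -lt0n (leq_ltn_trans _ tj).
rewrite addSn subSS natrB ?natrD ?tj ?mulr1n; last by lia.
by rewrite /a; field; rewrite j0.
Qed.

Lemma prod_residue_mod_p2 (s : rat) t : (t < p)%N -> s \in Zloc p ->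
  eqmodZloc p 2 (\prod_(1 <= j < p) (1 + p%:R * ((s - (t < j)%N%:R) / j%:R)))
                (1 + p%:R * harmonic t).
Proof.
move=> tp hs.
have hx j : (1 <= j < p)%N -> (s - (t < j)%N%:R) / j%:R \in Zloc p.
  by move=> hj; rewrite ZlocM ?Zloc_natV // Zloc_subr // Zloc_nat.
have [z hz zE] := eqmodZloc_elim (prod_1Dp_mod_p2 hx).
have [w hw wE] := eqmodZloc_elim harmonic_pred_prime.
(* The indicator removes the tail [H_(p-1) - H_t] from [s H_(p-1)]. *)
have sumE : \sum_(1 <= j < p) (s - (t < j)%N%:R) / j%:R =
            harmonic t + (s - 1) * harmonic p.-1.
  rewrite /harmonic prednK ?prime_gt0 // !(@big_cat_nat _ _ _ t.+1 1 p) //=.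
  rewrite mulrDr addrA; congr (_ + _).
    rewrite mulr_sumr -big_split /=; apply: eq_big_nat => j /andP[_ jt].
    by rewrite ltnNge -ltnS jt /=; ring.
  rewrite mulr_sumr; apply: eq_big_nat => j /andP[tj _].
  by rewrite tj.
apply: (eqmodZloc_intro (z := z + (s - 1) * w)).
  by rewrite ZlocD // ZlocM // Zloc_subr // Zloc1.
by rewrite zE sumE wE; ring.
Qed.

Lemma Zloc_harmonic t : (t < p)%N -> harmonic t \in Zloc p.
Proof.
move=> tp; apply: Zloc_sum => j /andP[j0 jt].
by rewrite Zloc_natV // j0 (leq_trans jt).
Qed.

Lemma gbinom_pred_prime_expr (a : rat) m : a \in Zloc p ->
  ~~ eqmodZloc p 1 a 0 ->
  eqmodZloc p (m + 2) (gbinom (a - 1) p.-1 ^+ m)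
    ((a - (residue p a)%:R) ^+ m / a ^+ m *
     (1 + m%:R * p%:R * harmonic (residue p a))).
Proof.
move=> ha ha0; have hV := ZlocV ha ha0.
have a0 : a != 0.
  by apply: contraNneq ha0 => ->; rewrite /eqmodZloc subrr mul0r Zloc0.
have [tp /eqmodZloc_elim[s hs aE]] := residue_spec p_prime ha.
set t := residue p a in tp aE *; rewrite expr1 in aE.
have aB := gbinom_pred_prime s tp; rewrite /= -aE in aB.
have := expr_1Dp_mod_p2 m (Zloc_harmonic tp) (prod_residue_mod_p2 tp hs).
move=> /eqmodZloc_elim[z hz]; set b := \prod_(_ <= _ < _) _ in aB * => bE.
have -> : gbinom (a - 1) p.-1 = (a - t%:R) / a * b.
  by apply: (mulfI a0); rewrite aB; field.
rewrite exprMn bE expr_div_n.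
(* The error [p^2 z] of [b ^+ m] is multiplied by [(a - t)^m / a^m = p^m s^m / a^m]; since [a] is a
   unit of Z_p, the quotient by [p^(m+2)] stays in Z_p. *)
apply: (eqmodZloc_intro (z := s ^+ m * a^-1 ^+ m * z)).
  by rewrite !ZlocM ?ZlocX.
have -> : a - t%:R = p%:R * s by rewrite {1}aE; ring.
by rewrite exprMn exprD exprVn; ring.
Qed.

End Localization.

Theorem theorem2p1 (m p : nat) (a : rat) (hm : (0 < m)%N) (hp : prime p)
    (hodd : odd p) (ha : a \in Zloc p) (ha0 : ~~ eqmodZloc p 1 a 0) :
  eqmodZloc p (m + 2)
    (\sum_(0 <= k < p) gbinom a k ^+ m *
       \sum_(0 <= r < ((m - 1) %/ 2).+1)
          'C(m, 2 * r + 1)%:R * (1 - 2%:R / a * k%:R) ^+ (2 * r + 1))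
    (\sum_(0 <= k < p) (-1) ^+ k * gbinom a k ^+ m *
       \sum_(0 <= r < (m %/ 2).+1)
          'C(m, 2 * r)%:R * (1 - 2%:R / a * k%:R) ^+ (2 * r))
  /\
  eqmodZloc p (m + 2)
    (\sum_(0 <= k < p) (-1) ^+ k * gbinom a k ^+ m *
       \sum_(0 <= r < (m %/ 2).+1)
          'C(m, 2 * r)%:R * (1 - 2%:R / a * k%:R) ^+ (2 * r))
    (2%:R ^+ (m - 1) * ((a - (residue p a)%:R) ^+ m / a ^+ m) *
       (1 + m%:R * p%:R * harmonic (residue p a))).
Proof.
have a0 : a != 0.
  by apply: contraNneq ha0 => ->; rewrite /eqmodZloc subrr mul0r Zloc0.
have pK := prednK (prime_gt0 hp).
(* As [p - 1] is even, both sums have the same closed form, and the first congruence is an equality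
   of rationals. *)
have sgn : (-1) ^+ p.-1 = 1 :> rat.
  by rewrite -signr_odd; move: hodd; rewrite -{1}pK /= => /negbTE ->.
rewrite -pK gbinom_sum_odd // gbinom_sum_even // pK sgn mul1r; split.
  by rewrite /eqmodZloc subrr mul0r Zloc0.
have [z hz zE] := eqmodZloc_elim hp (gbinom_pred_prime_expr hp hodd m ha ha0).
apply: (eqmodZloc_intro hp (z := 2%:R ^+ (m - 1) * z)).
  by rewrite ZlocM // ZlocX // Zloc_nat.
by rewrite zE; ring.
Qed.
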